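(* Let $m\ge1$, $k=\mathbb{F}_q$ and $R=R_{2,2m}=k[[X,Y]]/(Y(Y-X^m))$. For any $d\ge0$, $$\widehat{\nu}_{R,d}(0)=1.$$
   Context: Let $\widetilde{R}\simeq k[[T_1]]\times k[[T_2]]$ be the normalization of $R$. $\zeta^R_{R^d}(s)=\sum_N|R^d/N|^{-s}$ is the sum over finite-index $R$-submodules $N\subseteq R^d$, and $\zeta^{\widetilde{R}}_{\widetilde{R}^d}(s)=\sum_N|\widetilde{R}^d/N|^{-s}$ is the sum over finite-index $\widetilde{R}$-submodules $N\subseteq\widetilde{R}^d$. The finitized Coh zeta functions are $\widehat{\zeta}_{R,d}(s)=\zeta^R_{R^d}(s+d)$ and $\widehat{\zeta}_{\widetilde{R},d}(s)=\zeta^{\widetilde{R}}_{\widetilde{R}^d}(s+d)$. The normalized finitized Coh zeta function is $$\widehat{\nu}_{R,d}(s)=\frac{\widehat{\zeta}_{R,d}(s)}{\widehat{\zeta}_{\widetilde{R},d}(s)},$$ which is a polynomial in $q^{-s}$. *)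

(* Defs.v *)
From HB Require Import structures.
From mathcomp Require Import all_boot all_order all_algebra.
From mathcomp Require Import generic_quotient ring_quotient.
From mathcomp Require Import finmap.
From mathcomp Require Import all_classical all_reals all_analysis.

Set Implicit Arguments.
Unset Strict Implicit.
Unset Printing Implicit Defensive.

Import Order.TTheory GRing.Theory Num.Theory.

Local Open Scope classical_set_scope.
Local Open Scope ring_scope.
Local Open Scope quotient_scope.

(** * Formal power series *)

(* A record rather than an alias of [nat -> A], so that the Cauchy product is
   not confused with the pointwise product of functions. *)
Record fps (A : Type) := Fps { coefs : nat -> A }.

Lemma fpsP (A : Type) (f g : fps A) : coefs f =1 coefs g -> f = g.
Proof. by case: f g => [f] [g] /= /funext ->. Qed.

HB.instance Definition _ (A : Type) := gen_eqMixin (fps A).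
HB.instance Definition _ (A : Type) := gen_choiceMixin (fps A).

Section FpsRing.
Variable A : comNzRingType.
Implicit Types f g h : fps A.

Definition fps0 : fps A := Fps (fun=> 0).
Definition fps_opp f : fps A := Fps (fun n => - coefs f n).
Definition fps_add f g : fps A := Fps (fun n => coefs f n + coefs g n).
Definition fpsC (c : A) : fps A := Fps (fun n => if n == 0%N then c else 0).
Definition fpsX : fps A := Fps (fun n => (n == 1%N)%:R).
Definition fps_mul f g : fps A :=
  Fps (fun n => \sum_(i < n.+1) coefs f i * coefs g (n - i)).

Let fps_addA : associative fps_add.
Proof. by move=> f g h; apply: fpsP => n /=; rewrite addrA. Qed.
Let fps_addC : commutative fps_add.
Proof. by move=> f g; apply: fpsP => n /=; rewrite addrC. Qed.
Let fps_add0 : left_id fps0 fps_add.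
Proof. by move=> f; apply: fpsP => n /=; rewrite add0r. Qed.
Let fps_addN : left_inverse fps0 fps_opp fps_add.
Proof. by move=> f; apply: fpsP => n /=; rewrite addNr. Qed.

HB.instance Definition _ :=
  GRing.isZmodule.Build (fps A) fps_addA fps_addC fps_add0 fps_addN.

Let trunc N f : {poly A} := \poly_(i < N.+1) coefs f i.

Let truncM N f g n : (n <= N)%N ->
  coefs (fps_mul f g) n = (trunc N f * trunc N g)`_n.
Proof.
move=> nN; rewrite coefM /=; apply: eq_bigr => i _.
by rewrite !coef_poly !ltnS (leq_trans (leq_ord i) nN)
  (leq_trans (leq_subr _ _) nN).
Qed.

Let fps_mulC : commutative fps_mul.
Proof.
by move=> f g; apply: fpsP => n; rewrite !(truncM _ _ (leqnn n)) mulrC.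
Qed.

Let fps_mulA : associative fps_mul.
Proof.
have E f g h n : coefs (fps_mul (fps_mul f g) h) n =
    (trunc n f * trunc n g * trunc n h)`_n.
  rewrite coefM; apply: eq_bigr => i _.
  by rewrite (truncM f g (leq_ord i)) coef_poly ltnS leq_subr.
move=> f g h; apply: fpsP => n; rewrite E fps_mulC E.
by rewrite mulrC mulrA.
Qed.

Let fps_mul1 : left_id (fpsC 1) fps_mul.
Proof.
move=> f; apply: fpsP => n /=; rewrite big_ord_recl /= mul1r subn0.
by rewrite big1 ?addr0 // => i _; rewrite mul0r.
Qed.

Let fps_mulDl : left_distributive fps_mul fps_add.
Proof.
move=> f g h; apply: fpsP => n /=; rewrite -big_split /=.
by apply: eq_bigr => i _; rewrite mulrDl.
Qed.

Let fps_oner_neq0 : fpsC 1 != 0 :> fps A.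
Proof.
by apply/eqP => /(congr1 (fun f => coefs f 0)) /= /eqP; rewrite oner_eq0.
Qed.

HB.instance Definition _ := GRing.Zmodule_isComNzRing.Build (fps A)
  fps_mulA fps_mulC fps_mul1 fps_mulDl fps_oner_neq0.

Lemma coefsD f g n : coefs (f + g) n = coefs f n + coefs g n.
Proof. by []. Qed.
Lemma coefsB f g n : coefs (f - g) n = coefs f n - coefs g n.
Proof. by []. Qed.
Lemma coefsM f g n :
  coefs (f * g) n = \sum_(i < n.+1) coefs f i * coefs g (n - i).
Proof. by []. Qed.

End FpsRing.

Arguments fps0 {A}.
Arguments fpsX {A}.

Notation "{ 'fps' A }" := (fps A) (format "{ 'fps'  A }") : type_scope.

(** * The ring k[[X,Y]] / (Y (Y - X^m)) *)

Section R2.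
Variables (k : fieldType) (m : nat).

(* [k[[X,Y]]] is taken to be [k[[X]][[Y]]]. *)
Definition fpsX2 : {fps {fps k}} := fpsC fpsX.
Definition fpsY2 : {fps {fps k}} := fpsX.

Definition curve_eq : {fps {fps k}} := fpsY2 * (fpsY2 - fpsX2 ^+ m).

Definition curve_ideal : {pred {fps {fps k}}} :=
  fun f => `[< exists g, f = g * curve_eq >].

Lemma curve_ideal_closed : idealr_closed curve_ideal.
Proof.
split.
- by apply/asboolP; exists 0; rewrite mul0r.
- apply/asboolP => -[g] /(congr1 (fun f => coefs f 0)) /eqP.
  rewrite coefsM big_ord1 coefsM big_ord1 /= mul0r mulr0.
  by rewrite oner_eq0.
- move=> a u v /asboolP[g ->] /asboolP[h ->]; apply/asboolP.
  by exists (a * g + h); rewrite mulrDl mulrA.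
Qed.

HB.instance Definition _ := isIdealr.Build _ curve_ideal curve_ideal_closed.

Definition R2 : Type := {ideal_quot curve_ideal}.
HB.instance Definition _ := GRing.ComNzRing.on R2.

End R2.

(** * The normalization of k[[X,Y]] / (Y (Y - X^m)) *)

Definition nonzerodivisor (A : comNzRingType) (a : A) : Prop :=
  forall x : A, a * x = 0 -> x = 0.

(* [iota] identifies [B] with the integral closure of [A] in its total ring of
   fractions; the last two fields say that an element of [B] is a fraction
   integral over [A], and that a fraction [a / s] integral over [A] (its monic
   equation being written with denominators cleared) lies in [B]. *)
Record is_normalization (A B : comNzRingType) (iota : {rmorphism A -> B}) : Prop := {
  normalization_inj : injective iota;
  normalization_nzd s : nonzerodivisor s -> nonzerodivisor (iota s);
  normalization_int b : integralOver iota b /\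
    exists a s, nonzerodivisor s /\ iota s * b = iota a;
  normalization_closed a s : nonzerodivisor s ->
    (exists2 p : {poly A}, p \is monic &
      \sum_(i < size p) p`_i * a ^+ i * s ^+ ((size p).-1 - i) = 0) ->
    exists b, iota s * b = iota a
}.

Section FpsTheory.
Variable A : comNzRingType.
Implicit Types f g h : {fps A}.

Lemma coefs0M f g : coefs (f * g) 0 = coefs f 0 * coefs g 0.
Proof. by rewrite coefsM big_ord1. Qed.

Lemma coefsCM c f n : coefs (fpsC c * f) n = c * coefs f n.
Proof.
rewrite coefsM big_ord_recl /= subn0 big1 ?addr0 // => i _.
by rewrite mul0r.
Qed.

Lemma coefsXM f n : coefs (fpsX * f) n = if n is n'.+1 then coefs f n' else 0.
Proof.
rewrite coefsM; case: n => [|n]; first by rewrite big_ord1 /= mul0r.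
rewrite big_ord_recl /= mul0r add0r big_ord_recl /= mul1r subSS subn0.
by rewrite big1 ?addr0 // => i _; rewrite mul0r.
Qed.

Lemma coefsXnM m f n :
  coefs (fpsX ^+ m * f) n = if (m <= n)%N then coefs f (n - m) else 0.
Proof.
elim: m n => [|m IH] n; first by rewrite expr0 mul1r subn0.
rewrite exprS -mulrA coefsXM; case: n => // n; rewrite IH ltnS.
Qed.

Lemma fpsC_morph : {morph @fpsC A : x y / x - y} /\ {morph @fpsC A : x y / x * y}.
Proof.
split=> x y; apply: fpsP => n; last by rewrite coefsCM /=; case: eqP; rewrite ?mulr0.
by rewrite coefsB /=; case: eqP; rewrite ?subr0.
Qed.

Lemma fpsX_nzd m : nonzerodivisor (fpsX ^+ m : {fps A}).
Proof.
move=> f /(congr1 (@coefs _)) E; apply: fpsP => n.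
by move/(congr1 (fun u => u (n + m)%N)): E; rewrite coefsXnM leq_addl addnK.
Qed.

Lemma fps_divX f : coefs f 0 = 0 -> exists g, f = fpsX * g.
Proof.
move=> f0; exists (Fps (fun n => coefs f n.+1)); apply: fpsP => -[|n];
  by rewrite coefsXM.
Qed.

End FpsTheory.

Section FpsField.
Variable k : fieldType.
Implicit Types f g u v : {fps k}.

Let inv_seq (u : {fps k}) : nat -> seq k :=
  fix F n := if n is n'.+1 then
    rcons (F n') (((n' == 0%N)%:R - \sum_(i < n') (F n')`_i * coefs u (n' - i))
                  / coefs u 0)
  else [::].

Lemma fps_unit u : coefs u 0 != 0 -> exists v, u * v = 1.
Proof.
move=> u0; have sz n : size (inv_seq u n) = n.
  by elim: n => //= n IH; rewrite size_rcons IH.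
have nthE n i : (i < n)%N -> (inv_seq u n)`_i = (inv_seq u i.+1)`_i.
  elim: n => // n IH; rewrite ltnS leq_eqVlt => /orP[/eqP -> //|lt_in].
  by rewrite [LHS]/= nth_rcons sz lt_in IH.
pose v n := (inv_seq u n.+1)`_n.
have vE n : v n * coefs u 0 = (n == 0%N)%:R - \sum_(i < n) v i * coefs u (n - i).
  rewrite /v /= nth_rcons sz ltnn eqxx mulfVK //; congr (_ - _).
  by apply: eq_bigr => i _; rewrite (nthE n i).
exists (Fps v); apply: fpsP => n.
rewrite mulrC coefsM big_ord_recr subnn vE /= addrC subrK.
by case: eqP.
Qed.

Lemma fps_val f : f != 0 -> exists n u, f = fpsX ^+ n * u /\ coefs u 0 != 0.
Proof.
move=> /eqP f0.
have [n fn] : exists n, coefs f n != 0.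
  apply: contrapT => /forallNP N; apply: f0; apply: fpsP => n.
  by apply/eqP; apply: contrapT => /negP; apply: N.
elim: n f {f0} fn => [|n IH] f fn.
  by exists 0%N, f; rewrite expr0 mul1r.
have [f0|f0] := eqVneq (coefs f 0) 0; last first.
  by exists 0%N, f; rewrite expr0 mul1r.
have [g fg] := fps_divX f0; move: fn; rewrite fg coefsXM => /IH[i [u [-> u0]]].
by exists i.+1, u; rewrite exprS mulrA.
Qed.

Lemma fps_nzd f : f != 0 -> nonzerodivisor f.
Proof.
move=> /fps_val[n [u [-> /fps_unit[v uv]]]] g; rewrite -mulrA.
by move=> /fpsX_nzd E; rewrite -[g]mul1r -uv mulrAC E mul0r.
Qed.

Lemma fps_dvd_or f g : g != 0 ->
  (exists h, f = g * h) \/ (exists2 h, g = f * h & coefs h 0 = 0).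
Proof.
move=> g0; have [->|/fps_val[i [u [-> u0]]]] := eqVneq f 0.
  by left; exists 0; rewrite mulr0.
have [j [v [-> v0]]] := fps_val g0.
have [u' uu'] := fps_unit u0; have [v' vv'] := fps_unit v0.
have [le_ji|lt_ij] := leqP j i.
  left; exists (fpsX ^+ (i - j) * (u * v')).
  rewrite -{1}(subnKC le_ji) exprD -!mulrA; congr (_ * _).
  rewrite [v * _]mulrCA; congr (_ * _).
  by rewrite mulrCA vv' mulr1.
right; exists (fpsX ^+ (j - i) * (v * u')).
  rewrite -{1}(subnKC (ltnW lt_ij)) exprD -!mulrA; congr (_ * _).
  rewrite [u * _]mulrCA; congr (_ * _).
  by rewrite mulrCA uu' mulr1.
by rewrite -(prednK (_ : 0 < j - i)%N) ?subn_gt0 // exprS -mulrA coefsXM.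
Qed.

Lemma fps_int_closed x y (p : {poly {fps k}}) : y != 0 -> p \is monic ->
  \sum_(i < size p) p`_i * x ^+ i * y ^+ ((size p).-1 - i) = 0 ->
  exists h, x = y * h.
Proof.
move=> y0 mp; have [//|[w yE w0] E] := fps_dvd_or x y0; exfalso.
have x0 : x != 0 by apply: contraNneq y0 => x0; rewrite yE x0 mul0r.
have pw : (0 < size p)%N by rewrite size_poly_gt0 monic_neq0.
set e := (size p).-1 in E.
have xe : x ^+ e * \sum_(i < size p) p`_i * w ^+ (e - i) = 0.
  rewrite -[RHS]E mulr_sumr; apply: eq_bigr => i _.
  have ie : (i <= e)%N by rewrite -ltnS prednK.
  rewrite yE exprMn -{1}(subnKC ie) exprD.
  by rewrite -!mulrA; rewrite [RHS]mulrCA; congr (_ * _); rewrite mulrCA.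
have cancel n z : x ^+ n * z = 0 -> z = 0.
  elim: n => [|n IH]; first by rewrite expr0 mul1r.
  by rewrite exprS -mulrA => /(fps_nzd x0)/IH.
move/cancel: xe; rewrite -(prednK pw) -/e big_ord_recr /= subnn expr0 mulr1.
move/(congr1 (fun f => coefs f 0)).
have -> : p`_e = 1 by exact/eqP/mp.
rewrite coefsD (_ : coefs (\sum_(i < e) _) 0 = 0).
  by rewrite add0r => /eqP; rewrite oner_eq0.
elim/big_rec: _ => [//|i f _ f0]; rewrite coefsD f0 addr0 coefs0M.
by rewrite -(prednK (_ : 0 < e - i)%N) ?subn_gt0 // exprS coefs0M w0 mul0r mulr0.
Qed.

End FpsField.

Section Normalization.
Variables (k : fieldType) (m : nat) (m_gt0 : (0 < m)%N).
Implicit Types f g h : {fps {fps k}}.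
Let X : {fps k} := fpsX.

(* The series in [X] obtained by substituting [X^m] for [Y] in
   [\sum_l f_(j+l) Y^l]. *)
Definition fps_subst_from f j : {fps k} :=
  Fps (fun n => \sum_(l < n.+1 | (m * l <= n)%N)
                  coefs (coefs f (j + l)%N) (n - m * l)).

Let subst_fromS f j : fps_subst_from f j = coefs f j + X ^+ m * fps_subst_from f j.+1.
Proof.
apply: fpsP => n; rewrite coefsD coefsXnM /=.
rewrite big_mkcond big_ord_recl /= muln0 subn0 addn0; congr (_ + _).
case: ifP => [le_mn|lt_nm]; last first.
  by rewrite big1 // => i _; rewrite mulnS leqNgt ltn_addr // ltnNge lt_nm.
rewrite [RHS]big_mkcond /=.
rewrite (big_ord_widen n (fun l => if (m * l <= n - m)%N then
  coefs (coefs f (j.+1 + l)%N) (n - m - m * l) else 0));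
  last by rewrite ltn_subrL m_gt0 (leq_trans m_gt0).
rewrite [RHS]big_mkcond /=; apply: eq_bigr => i _.
rewrite /bump leq0n add1n mulnS -[(m + _ <= n)%N]leq_subRL // addSnnS subnDA.
case: ifP => le_i; last by case: ifP.
by rewrite ltnS (leq_trans _ le_i) // leq_pmull.
Qed.

Definition fps_subst f := fps_subst_from f 0.

Let Y_Xm : {fps {fps k}} := fpsY2 k - fpsX2 k ^+ m.

Let fpsX2n n : fpsX2 k ^+ n = fpsC (X ^+ n).
Proof. by elim: n => // n IH; rewrite !exprS IH (fpsC_morph _).2. Qed.

Let coefsY_Xm f n : coefs (Y_Xm * f) n =
  (if n is n'.+1 then coefs f n' else 0) - X ^+ m * coefs f n.
Proof. by rewrite mulrBl coefsB coefsXM fpsX2n coefsCM. Qed.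

Let subst_ex f : exists g, f = Y_Xm * g + fpsC (fps_subst f).
Proof.
exists (Fps (fun j => fps_subst_from f j.+1)); apply: fpsP => n.
rewrite coefsD coefsY_Xm /=; case: n => [|n] /=.
  by rewrite sub0r /fps_subst (subst_fromS f 0) addrC addrK.
by rewrite addr0 (subst_fromS f n.+1) addrK.
Qed.

Let subst0 g c : Y_Xm * g = fpsC c -> c = 0.
Proof.
move=> E; have En n : coefs (Y_Xm * g) n = coefs (fpsC c) n by rewrite E.
have g0 l : coefs g 0 = X ^+ (m * l) * coefs g l.
  elim: l => [|l ->]; first by rewrite muln0 expr0 mul1r.
  have := En l.+1; rewrite coefsY_Xm [RHS]/= => /eqP; rewrite subr_eq0 => /eqP ->.
  by rewrite mulrA -exprD -mulnSr.
have g00 : coefs g 0 = 0.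
  by apply: fpsP => n; rewrite (g0 n.+1) coefsXnM leqNgt leq_pmull.
by have := En 0%N; rewrite coefsY_Xm g00 mulr0 subr0 => /= <-.
Qed.

Let subst_uniq f g c : f = Y_Xm * g + fpsC c -> fps_subst f = c.
Proof.
have [h hE] := subst_ex f; rewrite {1}hE => E; apply/eqP; rewrite -subr_eq0.
apply/eqP/(@subst0 (g - h)); rewrite mulrBr (fpsC_morph _).1.
by apply/eqP; rewrite subr_eq addrAC [X in _ == X - _]addrC E addrK.
Qed.

Let substB f g : fps_subst (f - g) = fps_subst f - fps_subst g.
Proof.
have [f' fE] := subst_ex f; have [g' gE] := subst_ex g.
apply: (@subst_uniq _ (f' - g')); rewrite mulrBr (fpsC_morph _).1.
by rewrite {1}fE {1}gE opprD addrACA.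
Qed.

Let substC c : fps_subst (fpsC c) = c.
Proof. by apply: (@subst_uniq _ 0); rewrite mulr0 add0r. Qed.

Let substM f g : fps_subst (f * g) = fps_subst f * fps_subst g.
Proof.
have [f' fE] := subst_ex f; have [g' gE] := subst_ex g.
apply: (@subst_uniq _ (f' * g + fpsC (fps_subst f) * g')).
rewrite (fpsC_morph _).2 {1}fE mulrDl mulrDr mulrA -addrA; congr (_ + _).
by rewrite {1}gE mulrDr mulrCA.
Qed.

Let substY : fps_subst (fpsY2 k) = X ^+ m.
Proof. by apply: (@subst_uniq _ 1); rewrite mulr1 -fpsX2n subrK. Qed.

Definition branches f : {fps k} * {fps k} := (coefs f 0, fps_subst f).

Let branchesB f g : branches (f - g) = branches f - branches g.
Proof. by congr pair; rewrite ?substB. Qed.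

Let branchesM f g : branches (f * g) = branches f * branches g.
Proof. by congr pair; rewrite ?substM ?coefs0M. Qed.

Let branches1 : branches 1 = 1.
Proof. by congr pair; exact: substC. Qed.

Let branchesD f g : branches (f + g) = branches f + branches g.
Proof.
by apply/eqP; rewrite -subr_eq -branchesB addrK.
Qed.

Let branches_eq0 f : (branches f == 0) = (f \in @curve_ideal k m).
Proof.
apply/eqP/asboolP => [E|[g ->]].
  have [g fE] := fps_divX (congr1 fst E : coefs f 0 = 0).
  move/(congr1 snd): E; rewrite [LHS]/= fE substM substY => /fpsX_nzd g0.
  have [h] := subst_ex g; rewrite g0 (_ : fpsC 0 = 0) ?addr0 => [gE|].
    by exists h; rewrite gE mulrA mulrC.
  by apply: fpsP => n /=; case: ifP.
rewrite branchesM /curve_eq branchesM.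
rewrite (_ : branches (fpsY2 k) = (0, X ^+ m)); last by congr pair.
rewrite (_ : branches (_ - _) = (- X ^+ m, 0)).
  by congr pair; rewrite /= ?(mul0r, mulr0).
by congr pair; rewrite ?fpsX2n ?substB ?substY ?substC ?subrr //= sub0r.
Qed.

(* [X |-> (T_1, T_2)] and [Y |-> (0, T_2^m)]. *)
Definition R2_branches (x : R2 k m) : {fps k} * {fps k} := branches (repr x).

Let piR : {fps {fps k}} -> R2 k m := \pi_({ideal_quot @curve_ideal k m}).

Let R2_branchesE f : R2_branches (piR f) = branches f.
Proof.
apply/eqP; rewrite -subr_eq0 -branchesB branches_eq0.
by rewrite Quotient.idealrBE reprK.
Qed.

Let piRK x : piR (repr x) = x. Proof. exact: reprK. Qed.

Let piRB f g : piR (f - g) = piR f - piR g. Proof. exact: rmorphB. Qed.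
Let piRM f g : piR (f * g) = piR f * piR g. Proof. exact: rmorphM. Qed.
Let piR0 : piR 0 = 0. Proof. exact: rmorph0. Qed.
Let piR1 : piR 1 = 1. Proof. exact: rmorph1. Qed.

Let R2_branches_zmod : zmod_morphism R2_branches.
Proof.
by move=> x y; rewrite -[x]piRK -[y]piRK -piRB !R2_branchesE branchesB.
Qed.

Let R2_branches_monoid : monoid_morphism R2_branches.
Proof.
split=> [|x y]; first by rewrite -piR1 R2_branchesE branches1.
by rewrite -[x]piRK -[y]piRK -piRM !R2_branchesE branchesM.
Qed.

Let int_closed (A : comNzRingType) (phi : {rmorphism A -> {fps k}}) (a s : A)
    (p : {poly A}) : phi s != 0 -> p \is monic ->
  \sum_(i < size p) p`_i * a ^+ i * s ^+ ((size p).-1 - i) = 0 ->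
  exists t, phi s * t = phi a.
Proof.
move=> s0 mp E; have sz : size (map_poly phi p) = size p.
  by rewrite size_map_poly_id0 // (eqP mp) rmorph1 oner_neq0.
have [||t ->] := @fps_int_closed k (phi a) (phi s) (map_poly phi p) s0.
- exact: monic_map.
- rewrite sz -[RHS](rmorph0 phi) -[in RHS]E rmorph_sum; apply: eq_bigr => i _.
  by rewrite coef_map !rmorphM !rmorphXn.
by exists t.
Qed.

Lemma R2_normalization :
  exists iota : {rmorphism R2 k m -> {fps k} * {fps k}},
    (iota : R2 k m -> _) = R2_branches /\ is_normalization iota.
Proof.
have [iota iotaR] : exists iota : {rmorphism R2 k m -> {fps k} * {fps k}},
    (iota : R2 k m -> _) = R2_branches.
  pose iota : {rmorphism R2 k m -> {fps k} * {fps k}} := HB.pack R2_branches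
    (GRing.isZmodMorphism.Build _ _ _ R2_branches_zmod)
    (GRing.isMonoidMorphism.Build _ _ _ R2_branches_monoid).
  by exists iota.
have iotaE f : iota (piR f) = branches f by rewrite iotaR R2_branchesE.
have inj : injective iota.
  apply: raddf_inj => x ix0; rewrite -[x]piRK -piR0.
  apply/eqP; rewrite -Quotient.idealrBE subr0 -branches_eq0.
  by rewrite -iotaE piRK; apply/eqP.
have Xm_neq0 : X ^+ m != 0.
  apply/eqP => /(congr1 (fun u : {fps k} => coefs (u * 1) m)) /eqP.
  by rewrite mul0r coefsXnM leqnn subnn oner_eq0.
have branchesC c : branches (fpsC c) = (c, c) by congr pair; exact: substC.
have branchesY : branches (fpsY2 k) = (0, X ^+ m) by congr pair.
have nzdE s : nonzerodivisor s -> (iota s).1 != 0 /\ (iota s).2 != 0.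
  move=> nzs; split; apply/negP => /eqP s0.
  - have /nzs/(congr1 iota) : s * piR (Y_Xm) = 0.
      apply: inj; rewrite rmorphM rmorph0 iotaE /Y_Xm branchesB branchesY.
      rewrite fpsX2n branchesC.
      congr pair; first by rewrite s0 mul0r.
      by rewrite -[(_ - _).2]/(X ^+ m - X ^+ m) subrr mulr0.
    rewrite rmorph0 iotaE /Y_Xm branchesB branchesY fpsX2n branchesC.
    move/(congr1 fst)/eqP => /=.
    by rewrite sub0r oppr_eq0 (negPf Xm_neq0).
  - have /nzs/(congr1 iota) : s * piR (fpsY2 k) = 0.
      apply: inj; rewrite rmorphM rmorph0 iotaE branchesY.
      by congr pair; rewrite ?s0 ?(mul0r, mulr0).
    rewrite rmorph0 iotaE branchesY.
    by move/(congr1 snd)/eqP => /=; rewrite (negPf Xm_neq0).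
have nzdP (b : {fps k} * {fps k}) :
    b.1 != 0 -> b.2 != 0 -> nonzerodivisor b.
  move=> /fps_nzd b1 /fps_nzd b2 [x y] E.
  by rewrite [x]b1 1?[y]b2 //; [exact: (congr1 snd E) | exact: (congr1 fst E)].
exists iota; split=> //; split=> //.
- by move=> s /nzdE[s1 s2]; exact: nzdP.
- move=> b; split.
    exists (('X - (piR (fpsC b.1))%:P) * ('X - (piR (fpsC b.2))%:P)).
      by rewrite monicMl ?monicXsubC.
    rewrite rmorphM !rmorphB /= !map_polyX !map_polyC /= !iotaE !branchesC.
    rewrite rootE hornerM !hornerXsubC.
    by apply/eqP; congr pair => /=; rewrite subrr ?mul0r ?mulr0.
  exists (piR (fpsC (X ^+ m * b.1) + fpsY2 k * fpsC (b.2 - b.1))).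
  exists (piR (fpsC (X ^+ m))); split.
    move=> x /(congr1 iota); rewrite rmorphM rmorph0 iotaE branchesC.
    by move/(nzdP (_, _) Xm_neq0 Xm_neq0); rewrite -(rmorph0 iota) => /inj.
  rewrite !iotaE branchesD branchesM !branchesC branchesY.
  by congr pair => /=; rewrite ?mul0r ?addr0 // mulrBr addrC subrK.
- move=> a s /nzdE[s1 s2] [p mp E].
  have [h1 E1] := @int_closed _ (fst \o iota) a s p s1 mp E.
  have [h2 E2] := @int_closed _ (snd \o iota) a s p s2 mp E.
  by exists (h1, h2); rewrite [RHS]surjective_pairing -[(iota a).1]E1 -[(iota a).2]E2.
Qed.

End Normalization.

(** * Zeta functions of submodules and finitized Coh zeta functions *)

Section Zeta.
Variable A : comNzRingType.

Definition is_submodule (V : lmodType A) (N : set V) : Prop :=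
  submod_closed [in N].

Definition cosets (V : lmodType A) (N : set V) : set (set V) :=
  range (fun u : V => [set v | N (v - u)]).

(* [#|V / N|], meaningful when [N] has finite index. *)
Definition index (V : lmodType A) (N : set V) : nat :=
  #|` fset_set (cosets N)|.

Definition finite_index_submodules (V : lmodType A) : set (set V) :=
  [set N | is_submodule N /\ finite_set (cosets N)].

Arguments finite_index_submodules : clear implicits.

Variable K : realType.
Local Open Scope ereal_scope.

(* [\sum_N #|A^d / N|^(-s)] as an element of [[0, +oo]], for real [s]. *)
Definition zeta (d : nat) (s : K) : \bar K :=
  \esum_(N in finite_index_submodules 'rV[A]_d) ((index N)%:R `^ (- s))%:E.

Definition coh_zeta (d : nat) (s : K) : \bar K := zeta d (s + d%:R)%R.

End Zeta.

(* [fine +oo = 0] and [x / 0 = 0]: the quotient is nonzero only where both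
   series converge. *)
Definition nu_hat (A B : comNzRingType) (K : realType) (d : nat) (s : K) : K :=
  fine (coh_zeta A d s) / fine (coh_zeta B d s).

(* Main.v *)
Require Import Defs.
From HB Require Import structures.
From mathcomp Require Import all_boot all_order all_algebra.
From mathcomp Require Import generic_quotient ring_quotient.
From mathcomp Require Import finmap.
From mathcomp Require Import all_classical all_reals all_analysis.

(** Write O = k[[T]].  Both rings have the form A = O + yO, free with basis
    1, y and with y^2 = T^n y: for R take n = m and y = Y (division by the
    Weierstrass polynomial Y^2 - T^m Y), for the normalization O * O take n = 0
    and y = (0, 1).  So it suffices that the sum of [A^d : N]^(-d) over the
    finite-index submodules N of A^d be finite, nonzero and independent of n;
    it is in fact Z^2, where Z is the same sum for O^d ([natzeta_quadratic]).

    To see this, identify A^d with O^d * O^d by (u, w) |-> u + yw.  An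
    A-submodule is then an O-submodule N such that (u, w) \in N implies
    (0, u + T^n w) \in N.  Such an N is an extension of its first projection N1
    by its fibre L = { w | (0, w) \in N }, so that [A^d : N] = [O^d : N1]
    [O^d : L], and it is described by an O-linear map phi : N1 -> O^d / L with
    u + T^n phi(u) = 0.  A map phi exists iff N1 is contained in
    W = L + T^n O^d, because N1 is free; there are then [(L : T^n) : L]^d of
    them.  Fix L and let N1 run over the submodules of W, which is
    again isomorphic to O^d: the sum over N1 is [O^d : W]^(-d) Z, hence the
    contribution of L is
      [O^d : L]^(-d) * [(L : T^n) : L]^d * [O^d : W]^(-d) * Z.
    Multiplication by T^n on the finite module O^d / L has kernel (L : T^n) / L
    and cokernel O^d / W, so the two middle factors cancel
    ([index_liftable_colon]), and the sum over L is Z * Z.  The exponent d is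
    what makes them cancel.

    The finiteness of Z comes from the same fibration, applied to
    O^(1+d) = O * O^d without any condition linking u and w: it gives
    Z_(1+d) = zeta_O(1+d) * Z_d, and the zeta function of O is a convergent
    geometric series.  The fibration is therefore set up on O^e * O^d for the
    submodules with (u, w) \in N -> (0, u theta + c w) \in N, with theta a
    matrix and c a scalar ([stable_parametrization], [esum_stable]); the two
    uses are theta = 1, c = T^n and theta = 0, c = 0. *)

Set Implicit Arguments.
Unset Strict Implicit.
Unset Printing Implicit Defensive.

Import Order.TTheory GRing.Theory Num.Theory.

Local Open Scope classical_set_scope.
Local Open Scope ring_scope.
Local Open Scope quotient_scope.

(** * Indices of subgroups *)

Definition coset (V : zmodType) (N : set V) (u : V) : set V :=
  [set v | N (v - u)].

Notation finidx N := (finite_set (coset N @` setT)).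

Section Index.
Variable V : zmodType.
Implicit Types (N H W : set V) (u v : V) (T : finType).

Definition subgroup N := N 0 /\ forall u v, N u -> N v -> N (u - v).

(** Only meaningful for finitely many cosets, being 0 otherwise; [relindex setT N]
    is convertible to the index of a submodule [N]. *)
Definition relindex H N : nat := #|` fset_set (coset N @` H)|.

(** Counting is done on representatives indexed by a finite type: a product of
    indices then becomes a product of types, and no quotient is formed. *)
Definition residue_system H N T (r : T -> V) :=
  [/\ forall t, H (r t), forall v, H v -> exists t, N (v - r t)
    & forall t t', N (r t - r t') -> t = t'].

Lemma subgroupN N u : subgroup N -> N u -> N (- u).
Proof. by move=> [N0 NB] Nu; rewrite -sub0r; apply: NB. Qed.

Lemma subgroupD N u v : subgroup N -> N u -> N v -> N (u + v).
Proof. by move=> gN Nu Nv; rewrite -[v]opprK; apply: gN.2 => //; apply: subgroupN. Qed.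

Lemma subgroupC N u v : subgroup N -> N (u - v) -> N (v - u).
Proof. by move=> gN /(subgroupN gN); rewrite opprB. Qed.

Lemma subgroup_trans N u v w : subgroup N -> N (u - v) -> N (v - w) -> N (u - w).
Proof. by move=> gN /(subgroupD gN) h /h; rewrite subrKA. Qed.

Lemma coset_eqP N u v : subgroup N -> coset N u = coset N v <-> N (u - v).
Proof.
move=> gN; split=> [E|Nuv].
  have : coset N u u by rewrite /coset /= subrr; apply: gN.1.
  by rewrite E.
apply/seteqP; split=> w /= Nw; first exact: subgroup_trans Nw Nuv.
exact: subgroup_trans Nw (subgroupC gN Nuv).
Qed.

Lemma residue_system_relindex H N T (r : T -> V) : subgroup N -> residue_system H N r ->
  finite_set (coset N @` H) /\ relindex H N = #|T|.
Proof.
move=> gN [rH rex rinj].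
have E : coset N @` H = [set` [fset coset N (r t) | t in T]%fset].
  apply/seteqP; split=> [_ [u Hu <-]|_ /= /imfsetP[t _ ->]]; last by exists (r t).
  have [t Nt] := rex _ Hu; apply/imfsetP; exists t => //.
  by apply/coset_eqP.
rewrite /relindex E; split; first exact: finite_fset.
rewrite set_fsetK card_imfset /= -?cardE // => t t'.
by move=> /coset_eqP-/(_ gN)/rinj.
Qed.

Lemma residue_system_ex H N : finite_set (coset N @` H) -> subgroup N ->
  exists (T : finType) (r : T -> V), residue_system H N r /\ #|T| = relindex H N.
Proof.
move=> fin gN; pose T : finType := fset_set (coset N @` H).
have cosetT (t : T) : exists u, H u /\ coset N u = val t.
  by have := valP t; rewrite in_fset_set // inE => -[u Hu <-]; exists u.
have [r rP] := choice cosetT.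
exists T, r; have tr : residue_system H N r.
  split=> [t|v Hv|t t' /coset_eqP-/(_ gN)]; first by have [] := rP t.
    have vT : coset N v \in fset_set (coset N @` H).
      by rewrite in_fset_set // inE; exists v.
    exists [` vT]%fset; apply/coset_eqP => //.
    by have [_ ->] := rP [` vT]%fset.
  by have [_ ->] := rP t; have [_ ->] := rP t' => /val_inj.
by split=> //; have [_ ->] := residue_system_relindex gN tr.
Qed.

Lemma finite_relindex H N : finidx N -> finite_set (coset N @` H).
Proof. by apply: sub_finite_set; apply: image_subset. Qed.

(** A coset of the larger group is the saturation of a coset of the smaller. *)
Lemma finidx_sub N N' : N 0 -> subgroup N' -> N `<=` N' ->
  finidx N -> finidx N'.
Proof.
move=> N0 gN' sub fin.
pose sat C := [set v | exists2 x, C x & N' (v - x)].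
apply: sub_finite_set (finite_image sat fin) => _ [u _ <-].
exists (coset N u); first by exists u.
apply/seteqP; split=> [v [x /sub xu vx]|v vu]; first exact: subgroup_trans vx xu.
by exists u => //; rewrite /coset /= subrr.
Qed.

Lemma relindex_tower N H : subgroup N -> subgroup H -> N `<=` H ->
  finidx H -> finite_set (coset N @` H) ->
  finidx N /\
  relindex setT N = (relindex setT H * relindex H N)%N.
Proof.
move=> gN gH NH fH fN.
have [T1 [r1 [[_ ex1 in1] <-]]] := residue_system_ex fH gH.
have [T2 [r2 [[rH ex2 in2] <-]]] := residue_system_ex fN gN.
rewrite -card_prod; apply: (@residue_system_relindex _ _ _ (fun t => r1 t.1 + r2 t.2)).
  by [].
split=> // [v _|[t1 t2] [t1' t2']] /=.
  have [t1 /ex2[t2 Nt]] := ex1 v I.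
  by exists (t1, t2); rewrite opprD addrA.
move=> Nt; have t12 : t1 = t1'.
  apply: in1; have := NH _ Nt; rewrite opprD addrACA => Ht.
  rewrite -[_ - _](addrK (r2 t2 - r2 t2')); apply: gH.2 => //.
  exact: gH.2.
by congr pair=> //; apply: in2; move: Nt; rewrite t12 opprD addrACA subrr add0r.
Qed.

Lemma index_gt0 N : subgroup N -> finidx N ->
  (0 < relindex setT N)%N.
Proof.
move=> gN /residue_system_ex-/(_ gN)[T [r [[_ rex _] <-]]].
by have [t _] := rex 0 I; apply/card_gt0P; exists t.
Qed.

Lemma residue_system_setT : residue_system setT setT (fun=> 0 : V) (T := unit).
Proof. by split=> [//|v _|[] []//]; exists tt. Qed.

Lemma finidx_setT : finidx [set: V].
Proof. exact: (residue_system_relindex _ residue_system_setT).1. Qed.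

Lemma index_setT : relindex setT setT = 1%N.
Proof.
by rewrite (residue_system_relindex _ residue_system_setT).2 ?card_unit.
Qed.

End Index.

Section IndexMorphism.
Variables U V : zmodType.

Lemma finidx_preim (f : {additive U -> V}) (N : set V) :
  finidx N -> finidx (f @^-1` N).
Proof.
move=> fin; apply: sub_finite_set (finite_image (fun C => f @^-1` C) fin).
move=> _ [u _ <-]; exists (coset N (f u)); first by exists (f u).
by apply/seteqP; split=> v; rewrite /coset /= raddfB.
Qed.

(** The map f induces an isomorphism from U / M onto (f(U) + N) / N, and the
    cosets of [N] that meet [H] are the elements of the latter. *)
Lemma relindex_morph (f : {additive U -> V}) (M : set U) (H N : set V) :
  subgroup M -> subgroup N -> (forall u, N (f u) <-> M u) ->
  (forall u, H (f u)) -> (forall v, H v -> exists u, N (v - f u)) ->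
  finidx M ->
  finite_set (coset N @` H) /\ relindex H N = relindex setT M.
Proof.
move=> gM gN NM Hf Hex fM.
have [T [r [[_ ex inj] <-]]] := residue_system_ex fM gM.
apply: (@residue_system_relindex _ _ _ _ (f \o r)) => //.
split=> [t|v /Hex[u Nu]|t t']; [exact: Hf| |by rewrite -raddfB => /NM/inj].
have [t /NM] := ex u I; rewrite raddfB => Nt.
by exists t; apply: subgroup_trans Nu Nt.
Qed.

(** The extension 0 -> V / N2 -> (U * V) / N -> U / N1 -> 0. *)
Lemma index_prod (N : set (U * V)) :
  let N1 := [set u | exists w, N (u, w)] in let N2 := [set w | N (0, w)] in
  subgroup N ->
  finidx N1 -> finidx N2 ->
  finidx N /\
  relindex setT N = (relindex setT N1 * relindex setT N2)%N.
Proof.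
move=> N1 N2 gN f1 f2.
have g1 : subgroup N1.
  split=> [|u v [x ux] [y vy]]; first by exists 0; apply: gN.1.
  by exists (x - y); have := gN.2 _ _ ux vy.
have g2 : subgroup N2.
  split=> [|u v ux vy]; first exact: gN.1.
  by have := gN.2 _ _ ux vy; rewrite /N2 /= -[(0, u) - _]/(0 - 0, _) subrr.
have [T1 [r1 [[_ ex1 in1] <-]]] := residue_system_ex f1 g1.
have [T2 [r2 [[_ ex2 in2] <-]]] := residue_system_ex f2 g2.
rewrite -card_prod; apply: (@residue_system_relindex _ _ _ _ (fun t => (r1 t.1, r2 t.2))).
  by [].
split=> // [[a b] _|[t1 t2] [t1' t2']] /=.
  have [t1 [w aw]] := ex1 a I.
  have [t2 bt] := ex2 (b - w) I.
  exists (t1, t2); have := subgroupD gN aw bt.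
  by rewrite -[_ + _]/(_ + _, _ + _) addr0 /= addrA [w + _]addrC subrK.
move=> Nt; have t12 : t1 = t1' by apply: in1; exists (r2 t2 - r2 t2').
congr pair=> //; apply: in2; move: Nt; rewrite t12 /N2 /=.
by rewrite -[(_, _) - _]/(_ - _, _ - _) subrr.
Qed.

End IndexMorphism.

(** * Unordered sums *)

Section EsumExtra.
Variable K : realType.
Local Open Scope ereal_scope.

Lemma esumZl (T : choiceType) (D : set T) (c : K) (a : T -> \bar K) :
  (0 <= c)%R -> (forall i, D i -> 0 <= a i) ->
  \esum_(i in D) (c%:E * a i) = c%:E * \esum_(i in D) a i.
Proof.
move=> c0 a0; rewrite esum_mkcond [in RHS]esum_mkcond.
set b := fun i => if i \in D then a i else 0.
have b0 i : 0 <= b i by rewrite /b; case: ifPn => // /set_mem/a0.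
rewrite [in RHS]/esum -ereal_supZl //; last first.
  by apply/set0P; exists 0; exists set0; [exact: fsets_set0|rewrite fsbig_set0].
rewrite image_comp /esum; congr ereal_sup; apply: eq_imagel => X _ /=.
rewrite ge0_mule_fsumr //; apply: eq_fsbigr => i _.
by rewrite /b; case: ifP => //; rewrite mule0.
Qed.

Lemma esum_finType (T : finType) (x : \bar K) : 0 <= x ->
  \esum_(t in [set: T]) x = #|T|%:R%:E * x.
Proof.
move=> x0; rewrite esum_fset //; last exact: finite_finset.
rewrite (fsbigE (enum T)) ?enum_uniq //; last by move=> t; rewrite mem_enum.
rewrite big_enum_cond /= (eq_bigl predT) ?sumr_const ?mule_natl // => t.
by rewrite /= mem_setT.
Qed.

(** The zeta function of [V] at a natural number, where the weights are powers in
    a field and obey the algebra of integral exponents. *)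
Definition natzeta (A : comNzRingType) (V : lmodType A) (s : nat) : \bar K :=
  \esum_(N in @finite_index_submodules A V) (((Defs.index N)%:R ^- s)%R)%:E.

Lemma natzeta_coh_zeta (A : comNzRingType) d :
  coh_zeta A d (0 : K) = natzeta 'rV[A]_d d.
Proof.
rewrite /coh_zeta /zeta /natzeta add0r; apply: eq_esum => N _.
by rewrite powRN powR_mulrn.
Qed.

End EsumExtra.

(** * Finite-index submodules of free modules over k[[T]] *)

Section Basis.
Variable k : fieldType.
Local Notation O := {fps k}.

(** [is_submodule] with set membership in place of the boolean one. *)
Definition submod (A : comNzRingType) (V : lmodType A) (N : set V) :=
  N 0 /\ forall a u v, N u -> N v -> N (a *: u + v).

Lemma is_submoduleE (A : comNzRingType) (V : lmodType A) (N : set V) :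
  is_submodule N <-> submod N.
Proof.
split=> -[N0 NL]; split.
- by move: N0; rewrite inE.
- by move=> a u v Nu Nv; have := NL a u v; rewrite !inE; apply.
- by rewrite inE.
- by move=> a u v; rewrite !inE; apply: NL.
Qed.

Lemma submod_subgroup (A : comNzRingType) (V : lmodType A) (N : set V) :
  submod N -> subgroup N.
Proof.
move=> [N0 NL]; split=> // u v Nu Nv.
by rewrite addrC -scaleN1r; apply: NL.
Qed.

Lemma submodZ (A : comNzRingType) (V : lmodType A) (N : set V) a u :
  submod N -> N u -> N (a *: u).
Proof. by move=> [N0 NL] Nu; rewrite -[_ *: _]addr0; apply: NL. Qed.

Lemma submod_sum (A : comNzRingType) (V : lmodType A) (N : set V) (I : finType) (F : I -> V) :
  submod N -> (forall i, N (F i)) -> N (\sum_i F i).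
Proof.
move=> sN NF; elim/big_rec: _ => [|i v _ Nv]; first exact: sN.1.
exact: subgroupD (submod_subgroup sN) _ _.
Qed.

Lemma submod_mulmx (A : comNzRingType) e d (N : set 'rV[A]_d) (u : 'rV[A]_e)
    (B : 'M[A]_(e, d)) :
  submod N -> (forall i, N (row i B)) -> N (u *m B).
Proof. by move=> sN NB; rewrite mulmx_sum_row; apply: submod_sum => // i; apply: submodZ. Qed.

Definition row_span e d (B : 'M[O]_(e, d)) : set 'rV[O]_d := range (fun u : 'rV_e => u *m B).

Lemma submod_row_span e d (B : 'M[O]_(e, d)) : submod (row_span B).
Proof.
split=> [|a _ _ [u _ <-] [v _ <-]]; first by exists 0; rewrite ?mul0mx.
by exists (a *: u + v); rewrite // mulmxDl scalemxAl.
Qed.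

Definition rows_free e d (B : 'M[O]_(e, d)) := forall u : 'rV_e, u *m B = 0 -> u = 0.

(** Induction on the rank, as for Hermite normal forms.  Finite index provides an
    element of [N] with nonzero first coordinate; one whose first coordinate has
    minimal valuation is the first row of the basis, and the other rows come from
    the submodule of elements with first coordinate 0. *)
Lemma finidx_basis d (N : set 'rV[O]_d) : submod N -> finidx N ->
  exists2 B : 'M[O]_d, row_span B = N & rows_free B.
Proof.
elim: d N => [|d IH] N sN fN.
  exists 0; last by move=> u _; apply: thinmx0.
  apply/seteqP; split=> [_ [u _ <-]|u _]; first by rewrite mulmx0; apply: sN.1.
  by exists 0; rewrite // mulmx0; apply/rowP => -[].
have gN := submod_subgroup sN.
change (set 'rV[O]_(1 + d)) in N.
pose inr (w : 'rV[O]_d) : 'rV[O]_(1 + d) := row_mx 0 w.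
have inrA : zmod_morphism inr by move=> u v; rewrite /inr opp_row_mx add_row_mx subr0.
pose inrM : {additive 'rV[O]_d -> 'rV[O]_(1 + d)} :=
  HB.pack inr (GRing.isZmodMorphism.Build _ _ _ inrA).
have [||B BN iB] := IH (inr @^-1` N).
- split=> [|a u v Nu Nv] /=; first by rewrite /inr row_mx0; apply: sN.1.
  have -> : inr (a *: u + v) = a *: inr u + inr v.
    by rewrite /inr scale_row_mx add_row_mx scaler0 addr0.
  exact: sN.2.
- exact: (@finidx_preim _ _ inrM).
have [p [Np p0 pdvd]] : exists p, [/\ N p, p 0 0 != 0
    & forall v, N v -> exists c, v 0 0 = c * p 0 0].
  have [v Nv v0] : exists2 v, N v & v 0 0 != 0.
    (* two of the powers of the variable are congruent modulo N *)
    have [T [r [[_ rex _] _]]] := residue_system_ex fN gN.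
    have [t tP] := choice (fun i : 'I_(#|T|.+1) => rex (\row_j fpsX ^+ i) I).
    have /injectivePn[i [j ij tij]] : ~~ injectiveb t.
      by apply/negP => /injectiveP/leq_card; rewrite card_ord ltnn.
    have Nij : N (\row_l fpsX ^+ i - \row_l fpsX ^+ j).
      by apply: subgroup_trans (tP i) _ => //; rewrite tij; apply: subgroupC (tP j).
    exists (\row_l fpsX ^+ i - \row_l fpsX ^+ j) => //; rewrite !mxE subr_eq0.
    apply/eqP => /(congr1 (fun f => coefs (f * 1) i)); rewrite !coefsXnM leqnn subnn.
    case: (leqP j i) => [le_ji|_] /eqP; last by rewrite oner_eq0.
    rewrite /= subn_eq0 leqNgt ltn_neqAle le_ji andbT negbK.
    case: ifP => [/eqP/val_inj ij'|_ /eqP e10]; last by move: (oner_neq0 k); rewrite e10 eqxx.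
    by rewrite ij' eqxx in ij.
  pose P n := `[< exists2 v, N v & exists2 w, v 0 0 = fpsX ^+ n * w & coefs w 0 != 0 >].
  have exP : exists n, P n.
    have [n [w [vE w0]]] := fps_val v0.
    by exists n; apply/asboolP; exists v => //; exists w.
  case: (ex_minnP exP) => n /asboolP[p Np [w pE w0]] nmin.
  have [w' ww'] := fps_unit w0.
  exists p; split=> // [|u Nu].
    apply/eqP => p00; move: pE; rewrite p00 => /esym/fpsX_nzd w00.
    by move: w0; rewrite w00 eqxx.
  have [->|/fps_val[m [z [uE z0]]]] := eqVneq (u 0 0) 0.
    by exists 0; rewrite mul0r.
  have le_nm : (n <= m)%N by apply: nmin; apply/asboolP; exists u => //; exists z.
  exists (fpsX ^+ (m - n) * z * w'); rewrite uE pE -{1}(subnK le_nm) exprD.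
  rewrite -!mulrA; congr (_ * _).
  by rewrite [w' * _]mulrCA [w' * w]mulrC ww' mulr1 mulrC.
pose M : 'M[O]_(1 + d) := col_mx p (row_mx 0 B).
have ME (u : 'rV_(1 + d)) : u *m M = lsubmx u 0 0 *: p + inr (rsubmx u *m B).
  rewrite -[u in LHS]hsubmxK mul_row_col {1}[lsubmx u]mx11_scalar mul_scalar_mx.
  by rewrite mul_mx_row mulmx0.
have Ninr w : row_span B w <-> N (inr w) by rewrite BN.
have inr00 w : inr w 0 0 = 0.
  have <- : (row_mx 0 w : 'rV[O]_(1 + d)) 0 (lshift d 0) = 0 by rewrite row_mxEl mxE.
  by congr (row_mx _ _ _ _); apply: val_inj.
exists M.
  apply/seteqP; split=> [_ [u _ <-]|v Nv]; first change ('rV[O]_(1 + d)) in u.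
    by rewrite ME; apply: sN.2 => //; apply/Ninr; exists (rsubmx u).
  have [c vc] := pdvd v Nv.
  change ('rV[O]_(1 + d)) in v.
  have vE : v - c *: p = inr (rsubmx (v - c *: p)).
    rewrite -[LHS]hsubmxK /inr; congr row_mx; apply/rowP => i; rewrite ord1 !mxE.
    rewrite (_ : lshift d 0 = 0); last exact: val_inj.
    by rewrite vc subrr.
  have /Ninr[w _ wE] : N (inr (rsubmx (v - c *: p))).
    by rewrite -vE addrC -scaleNr; apply: sN.2.
  exists (row_mx c%:M w) => //; rewrite ME row_mxKl row_mxKr wE -vE mxE mulr1n.
  by rewrite addrC subrK.
move=> u; change ('rV[O]_(1 + d)) in u; rewrite ME => E.
have u0 : lsubmx u 0 0 = 0.
  apply: (fps_nzd p0); move/(congr1 (fun v : 'rV_(1 + d) => v 0 0)): E.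
  by rewrite mxE inr00 addr0 mxE [RHS]mxE mulrC.
move: E; rewrite u0 scale0r add0r => /(congr1 (@rsubmx _ 1 1 d)).
rewrite row_mxKr linear0 => /iB ru0.
by rewrite -[u]hsubmxK ru0 [lsubmx u]mx11_scalar u0 raddf0 row_mx0.
Qed.

End Basis.

(** * The fibration of submodules of a direct sum *)

Section Fibration.
Variables (k : fieldType) (e d : nat).
Local Notation O := {fps k}.
Local Notation E := ('rV[O]_e * 'rV[O]_d)%type.
Variables (theta : 'M[O]_(e, d)) (c : O).

(** For theta = 1 and c = T^n the condition is stability under multiplication by y
    on O^d + y O^d, where y^2 = T^n y; for theta = 0 and c = 0 it is empty. *)
Definition stable : set (set E) := [set N | finite_index_submodules N /\
  forall x w, N (x, w) -> N (0, x *m theta + c *: w)].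

Definition fiber (N : set E) : set 'rV[O]_d := [set w | N (0, w)].

(** A stable submodule with fibre [L] projects into [liftable L], since
    (x, w) in N gives (0, x theta + c w) in N. *)
Definition liftable (L : set 'rV[O]_d) : set 'rV[O]_e :=
  [set x | exists w, L (x *m theta + c *: w)].

Definition colon (L : set 'rV[O]_d) : set 'rV[O]_d := [set w | L (c *: w)].

Lemma finite_indexP (A : comNzRingType) (V : lmodType A) (N : set V) :
  finite_index_submodules N <-> submod N /\ finidx N.
Proof. by split=> -[/is_submoduleE]. Qed.

Lemma submod_fiber N : submod N -> submod (fiber N).
Proof.
move=> sN; split=> [|a u v Nu Nv]; first exact: sN.1.
have := sN.2 a _ _ Nu Nv.
by rewrite /fiber /= -[_ *: (0, u) + _]/(a *: 0 + 0, a *: u + v) scaler0 addr0.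
Qed.

Lemma finite_index_fiber N : finite_index_submodules N -> finite_index_submodules (fiber N).
Proof.
move=> /finite_indexP[sN fN]; apply/finite_indexP; split; first exact: submod_fiber.
pose f (w : 'rV[O]_d) : E := (0, w).
have fA : zmod_morphism f by move=> u v; rewrite /f -[RHS]/(0 - 0, u - v) subr0.
pose fM : {additive 'rV[O]_d -> E} := HB.pack f (GRing.isZmodMorphism.Build _ _ _ fA).
exact: (@finidx_preim _ _ fM).
Qed.

Lemma submod_liftable L : submod L -> submod (liftable L).
Proof.
move=> sL; split=> [|a u v [w uw] [z vz]].
  by exists 0; rewrite mul0mx scaler0 addr0; apply: sL.1.
exists (a *: w + z).
rewrite mulmxDl -scalemxAl scalerDr scalerA [c * a]mulrC -scalerA addrACA -scalerDr.
exact: sL.2.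
Qed.

Lemma submod_colon L : submod L -> submod (colon L).
Proof.
move=> sL; split=> [|a u v Lu Lv]; rewrite /colon /=.
  by rewrite scaler0; apply: sL.1.
by rewrite scalerDr scalerA [c * a]mulrC -scalerA; apply: sL.2.
Qed.

Lemma finite_index_liftable L : finite_index_submodules L ->
  finite_index_submodules (liftable L).
Proof.
move=> /finite_indexP[sL fL]; apply/finite_indexP; split; first exact: submod_liftable.
apply: (@finidx_sub _ (mulmxr theta @^-1` L)).
- by rewrite /= mul0mx; apply: sL.1.
- exact/submod_subgroup/submod_liftable.
- by move=> u Lu; exists 0; rewrite scaler0 addr0.
- exact: finidx_preim.
Qed.

(** The stable submodules with fibre [L].  Let W = [liftable L] have basis B, and
    choose C with B theta + c C in L, row by row.  Such an N has a first
    projection N1 B with N1 in O^e; a basis M of N1 gives the basis M B of the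
    projection, and N is determined by lifts of the rows of M B, which are the
    rows of M C up to elements of (L : c), themselves only relevant modulo L.
    So N corresponds to N1 and e residues of (L : c) modulo L.  Parametrizing by N1 rather than
    by N1 B makes the sum over the projections a full zeta sum of O^e. *)
Lemma stable_parametrization L : finite_index_submodules L ->
  exists (T : finType) (F : set 'rV[O]_e * {ffun 'I_e -> T} -> set E),
  [/\ #|T| = relindex (colon L) L,
      set_bij ([set N | finite_index_submodules N] `*` setT)
        [set N | stable N /\ fiber N = L] F
    & forall p, finite_index_submodules p.1 ->
      relindex setT (F p) =
        (relindex setT (liftable L) * relindex setT p.1 * relindex setT L)%N].
Proof.
move=> LS; have [sL fL] := (finite_indexP _).1 LS; have gL := submod_subgroup sL.
have [sW fW] := (finite_indexP _).1 (finite_index_liftable LS).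
have [B BW iB] := finidx_basis sW fW.
have [T [r [[rH rex rinj] rT]]] := residue_system_ex (finite_relindex (colon L) fL) gL.
have [C CP] : exists C : 'M[O]_(e, d), forall i, L (row i (B *m theta + c *: C)).
  have /choice[C CP] i : exists w, L (row i B *m theta + c *: w).
    by have : row_span B (row i B) by [exists (delta_mx 0 i); rewrite // -rowE]; rewrite BW.
  exists (\matrix_i C i) => i; have := CP i.
  by rewrite linearD /= linearZ /= rowK row_mul.
have /choice[M MP] (N : set 'rV[O]_e) : exists M : 'M[O]_e,
    finite_index_submodules N -> row_span M = N /\ rows_free M.
  have [/finite_indexP[sN fN]|nN] := pselect (finite_index_submodules N); last by exists 0.
  by have [A AN iA] := finidx_basis sN fN; exists A.
pose R (t : {ffun 'I_e -> T}) : 'M[O]_(e, d) := \matrix_i r (t i).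
pose F (p : set 'rV[O]_e * {ffun 'I_e -> T}) : set E :=
  [set x | exists u n, L n /\
     x = (u *m M p.1 *m B, u *m (M p.1 *m C + R p.2) + n)].
have sF p : submod (F p).
  split=> [|a _ _ [u [n [Ln ->]]] [v [l [Ll ->]]]].
    by exists 0, 0; rewrite !mul0mx addr0; split=> //; apply: gL.1.
  exists (a *: u + v), (a *: n + l); split; first exact: sL.2.
  rewrite -[LHS]/(_ *: _ + _, _ *: _ + _); congr pair.
    by rewrite !mulmxDl -!scalemxAl.
  by rewrite mulmxDl -scalemxAl addrACA -scalerDr.
have fibF p : finite_index_submodules p.1 -> fiber (F p) = L.
  move=> /MP[_ iM]; apply/seteqP; split=> [w [u [n [Ln]]]|w Lw].
    move=> [/esym/iB/iM -> ->]; by rewrite mul0mx add0r.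
  by exists 0, w; rewrite !mul0mx add0r.
(* the projection of F p is p.1 B, and B is injective, so it recovers p.1 *)
have baseF p : finite_index_submodules p.1 ->
    forall u, (exists w, F p (u *m B, w)) <-> p.1 u.
  move=> /MP[{2}<- iM] u; split=> [[w [v [n [Ln [uv _]]]]]|[v _ <-]].
    exists v => //; apply/eqP; rewrite -subr_eq0; apply/eqP/iB.
    by rewrite mulmxBl uv subrr.
  by exists (v *m (M p.1 *m C + R p.2) + 0), v, 0; split=> //; apply: gL.1.
have idxF p : finite_index_submodules p.1 -> finidx (F p) /\
    relindex setT (F p) =
        (relindex setT (liftable L) * relindex setT p.1 * relindex setT L)%N.
  move=> pS; have [sp fp] := (finite_indexP _).1 pS.
  pose N1 := [set u | exists w, F p (u, w)].
  have gN1 : subgroup N1.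
    split=> [|u v [x ux] [y vy]]; first by exists 0; apply: (sF p).1.
    by exists (x - y); have := (submod_subgroup (sF p)).2 _ _ ux vy.
  have gW := submod_subgroup sW.
  have N1W : N1 `<=` liftable L.
    by move=> _ [w [u [n [_ [-> _]]]]]; rewrite -BW; exists (u *m M p.1).
  have [fN1 iN1] : finite_set (coset N1 @` liftable L) /\
      relindex (liftable L) N1 = relindex setT p.1.
    apply: (@relindex_morph _ _ (mulmxr B)) => //; first exact: submod_subgroup.
    - exact: baseF.
    - by move=> u; rewrite -BW; exists u.
    - move=> v; rewrite -BW => -[u _ <-]; exists u; rewrite subrr; exact: gN1.1.
  have [fN1T iN1T] := relindex_tower gN1 gW N1W fW fN1.
  have := index_prod (submod_subgroup (sF p)); rewrite /= -/N1 -iN1 -iN1T.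
  by rewrite -[[set w | _]]/(fiber (F p)) (fibF p pS); apply.
exists T, F; split; [exact: rT | | by move=> p /idxF[]].
split.
- move=> p /= [pS _]; have [fp _] := idxF p pS; split; last exact: fibF.
  split; first exact/finite_indexP.
  move=> _ _ [u [n [Ln [-> ->]]]]; have : fiber (F p) = L by exact: fibF.
  rewrite -[F p _]/(fiber (F p) _) => ->.
  rewrite scalerDr addrA; apply: (subgroupD gL); last exact: submodZ.
  rewrite -!mulmxA scalemxAr -mulmxDr; apply: submod_mulmx => // i.
  rewrite scalerDr addrA scalemxAr -mulmxDr linearD /= row_mul.
  apply: (subgroupD gL); first exact: submod_mulmx.
  by rewrite linearZ /= rowK; apply: rH.
- move=> [N t] [N' t'] /set_mem[/= NS _] /set_mem[/= NS' _] FE.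
  have NN : N = N'.
    apply/seteqP; split=> u Nu.
      by apply/(baseF (N', t') NS'); rewrite -FE; apply/(baseF (N, t) NS).
    by apply/(baseF (N, t) NS); rewrite FE; apply/(baseF (N', t') NS').
  rewrite -{}NN in FE NS' *; congr pair; apply/ffunP => i; apply: rinj.
  have [_ iM] := MP N NS.
  have : F (N, t) (row i (M N) *m B, row i (M N *m C + R t)).
    exists (delta_mx 0 i), 0; split; first exact: gL.1.
    by rewrite addr0 -!rowE.
  rewrite FE => -[u [n [Ln [Eu]]]].
  have -> : u = delta_mx 0 i.
    apply/eqP; rewrite -subr_eq0; apply/eqP/iM/iB.
    by rewrite !mulmxBl -rowE Eu subrr.
  rewrite -rowE /= !linearD /= -addrA => /addrI; rewrite !rowK => ->.
  by rewrite addrAC subrr add0r.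
- move=> N [[/finite_indexP[sN fN] stN] NL]; have gN := submod_subgroup sN.
  pose N1 := [set u | exists w, N (u *m B, w)].
  have N1S : finite_index_submodules N1.
    apply/finite_indexP; split.
      split=> [|a u v [w uw] [z vz]]; first by exists 0; rewrite mul0mx; apply: sN.1.
      by exists (a *: w + z); rewrite mulmxDl -scalemxAl; have := sN.2 a _ _ uw vz.
    pose f (u : 'rV[O]_e) : E := (u *m B, 0).
    have fA : zmod_morphism f.
      by move=> u v; rewrite /f mulmxBl -[RHS]/(_, 0 - 0) subr0.
    pose fM : {additive 'rV[O]_e -> E} := HB.pack f (GRing.isZmodMorphism.Build _ _ _ fA).
    apply: (@finidx_sub _ (fM @^-1` N)); last exact: finidx_preim.
    - by rewrite /= /f mul0mx; apply: sN.1.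
    - split=> [|u v [w uw] [z vz]]; first by exists 0; rewrite mul0mx; apply: sN.1.
      by exists (w - z); rewrite mulmxBl; have := gN.2 _ _ uw vz.
    - by move=> u Nu; exists 0.
  have [MN1 iM] := MP N1 N1S.
  have /choice[w wP] i : exists w, N (row i (M N1) *m B, w).
    have : row_span (M N1) (row i (M N1)) by exists (delta_mx 0 i); rewrite // -rowE.
    by rewrite MN1.
  (* both w i and the row of M C solve x theta + c w = 0 modulo L for the same x *)
  have wH i : colon L (w i - row i (M N1 *m C)).
    rewrite /colon /=; have := stN _ _ (wP i).
    rewrite -[N _]/(fiber N _) NL => Lw.
    have := gL.2 _ _ Lw (submod_mulmx (row i (M N1)) sL CP).
    by rewrite mulmxDr mulmxA opprD addrACA subrr add0r -scalemxAr row_mul scalerBr.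
  have /choice[t tP] i := rex _ (wH i).
  exists (N1, finfun t); first by [].
  have FN i : N (row i (M N1) *m B, row i (M N1 *m C + R (finfun t))).
    have : N (0, w i - row i (M N1 *m C) - r (t i)).
      by rewrite -[N _]/(fiber N _) NL.
    move=> /(gN.2 _ _ (wP i)); rewrite -[_ - _]/(_ - 0, _ - _) subr0.
    rewrite [row i (_ + _)]linearD /= rowK ffunE; congr N; congr pair.
    by rewrite !opprB addrCA [w i + _]addrC subrK addrC.
  have FsN : F (N1, finfun t) `<=` N.
    move=> _ [u [n [Ln ->]]]; rewrite -[(_, _)]addr0.
    have : N (0, n) by rewrite -[N _]/(fiber N n) NL.
    move=> /(subgroupD gN); rewrite addr0 /=.
    set z := M N1 *m C + _ in FN *.
    have zN : N (u *m M N1 *m B, u *m z).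
      have : N (\sum_i u 0 i *: (row i (M N1) *m B, row i z)).
        by apply: submod_sum => // i; apply: submodZ.
      congr N; rewrite [LHS]surjective_pairing; congr pair.
        rewrite -mulmxA mulmx_sum_row; rewrite (raddf_sum (@fst _ _)).
        by apply: eq_bigr => i _; rewrite row_mul.
      rewrite mulmx_sum_row (raddf_sum (@snd _ _)).
      by apply: eq_bigr => i _.
    by move=> /(_ _ zN); rewrite -[(_, _) + _]/(_ + _, _ + _) add0r addrC.
  (* an element of N differs from one of F by an element of the common fibre *)
  apply/seteqP; split=> // -[x y] Nxy.
  have : liftable L x.
    by exists y; have := stN _ _ Nxy; rewrite -[N _]/(fiber N _) NL.
  rewrite -BW => -[v _ vx].
  have : row_span (M N1) v by rewrite MN1; exists y; rewrite vx.
  case=> u _ uv.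
  pose y' := u *m (M N1 *m C + R (finfun t)).
  have Fx : F (N1, finfun t) (x, y').
    exists u, 0; rewrite addr0; split; first exact: gL.1.
    by rewrite /= uv vx.
  exists u, (y - y'); split; last by rewrite /= uv vx subrKC.
  have := gN.2 _ _ Nxy (FsN _ Fx); rewrite -[_ - _]/(x - x, y - y') subrr.
  by rewrite -[N _]/(fiber N _) NL.
Qed.

End Fibration.

(** * Zeta sums along the fibration *)

Section FibrationSum.
Variables (K : realType) (k : fieldType) (e d : nat).
Local Notation O := {fps k}.
Local Notation E := ('rV[O]_e * 'rV[O]_d)%type.
Variables (theta : 'M[O]_(e, d)) (c : O).
Local Open Scope ereal_scope.

(** Group the stable submodules by their fibre [L]; on each group the parametrization
    turns the sum into a zeta sum over O^e, repeated once for each of the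
    [(L : c) : L]^e choices of residues. *)
Lemma esum_stable (s : nat) :
  \esum_(N in stable theta c) ((relindex setT N)%:R ^- s : K)%:E =
  \esum_(L in @finite_index_submodules O 'rV[O]_d)
    (((relindex (colon c L) L)%:R ^+ e
      / ((relindex setT (liftable theta c L))%:R * (relindex setT L)%:R) ^+ s : K)%:E
     * natzeta K 'rV[O]_e s).
Proof.
pose S := @finite_index_submodules O 'rV[O]_d.
pose Q L := [set N : set E | stable theta c N /\ fiber N = L].
rewrite (@reindex_esum _ _ _ (S `*`` Q) _ snd); last first.
  split=> [[L N] [_ [sN _]] //|[L N] [L' N'] /set_mem[/= _ [_ <-]] /set_mem[/= _ [_ <-]] -> //|N sN].
  by exists (fiber N, N) => //; split=> //=; apply: finite_index_fiber; case: sN.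
have pos (n : nat) : 0 <= ((n%:R : K) ^- s)%:E by rewrite lee_fin invr_ge0 exprn_ge0.
rewrite -(@esum_esum _ _ _ S Q (fun _ N => ((relindex setT N)%:R ^- s : K)%:E)) //.
apply: eq_esum => L LS.
have [T [F [cT bF iF]]] := stable_parametrization theta c LS.
rewrite (@reindex_esum _ _ _ _ _ _ _ bF).
pose a (N : set 'rV[O]_e) := ((relindex setT (liftable theta c L) * relindex setT N
  * relindex setT L)%N%:R ^- s : K)%:E.
transitivity (\esum_(N in @finite_index_submodules O 'rV[O]_e)
    \esum_(t in [set: {ffun 'I_e -> T}]) a N).
  rewrite (@esum_esum _ _ _ _ (fun=> setT) (fun N _ => a N)).
    by apply: eq_esum => p [pS _]; rewrite iF.
  by move=> *; apply: pos.
rewrite /natzeta -esumZl.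
- apply: eq_esum => N _; rewrite esum_finType; last exact: pos.
  rewrite /a -!EFinM card_ffun card_ord cT !natrM natrX !exprMn !invfM.
  by rewrite -!mulrA; congr (_ * (_ * _))%:E; rewrite mulrC.
- by rewrite divr_ge0 ?exprn_ge0 // mulr_ge0.
- by move=> N _; apply: pos.
Qed.

End FibrationSum.

Section BaseColon.
Variables (k : fieldType) (d : nat).
Local Notation O := {fps k}.
Variable c : O.

(** Multiplication by c on the finite module O^d / L: its kernel (L : c) / L and its
    cokernel O^d / (L + c O^d) have the same number of elements. *)
Lemma index_liftable_colon (L : set 'rV[O]_d) : finite_index_submodules L ->
  relindex setT (liftable 1%:M c L) = relindex (colon c L) L.
Proof.
move=> LS; have [sL fL] := (finite_indexP _).1 LS; have gL := submod_subgroup sL.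
have [sW fW] := (finite_indexP _).1 (finite_index_liftable 1%:M c LS).
have gW := submod_subgroup sW.
have gH := submod_subgroup (submod_colon c sL).
have LH : L `<=` colon c L by move=> u Lu; apply: submodZ.
have LW : L `<=` liftable 1%:M c L.
  by move=> u Lu; exists 0; rewrite mulmx1 scaler0 addr0.
have fH : finidx (colon c L) := finidx_sub gL.1 gH LH fL.
have [_ iH] := relindex_tower gL gH LH fH (finite_relindex _ fL).
have [_ iW] := relindex_tower gL gW LW fW (finite_relindex _ fL).
have [_ E] : finite_set (coset L @` liftable 1%:M c L) /\
    relindex (liftable 1%:M c L) L = relindex setT (colon c L).
  apply: (relindex_morph (f := *:%R c)) => // [u|v [w vw]].
    by exists (- u); rewrite mulmx1 scalerN subrr; apply: gL.1.
  by exists (- w); rewrite /= scalerN opprK -[v]mulmx1.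
move: iH; rewrite iW E mulnC => /eqP.
by rewrite eqn_pmul2l; [move/eqP | apply: index_gt0].
Qed.

End BaseColon.

Section Transport.
Variables (K : realType) (k : fieldType) (e d : nat).
Local Notation O := {fps k}.
Local Notation E := ('rV[O]_e * 'rV[O]_d)%type.
Variables (theta : 'M[O]_(e, d)) (c : O).
Variables (A : comNzRingType) (V : lmodType A).
Local Open Scope ereal_scope.

(** Transport to a module over another ring: only the subgroups that are submodules
    have to match, not the scalars. *)
Lemma natzeta_stable (J : {additive E -> V}) (J' : V -> E) (s : nat) :
  cancel J J' -> cancel J' J ->
  (forall N : set V, submod N <-> submod (J @^-1` N) /\
     forall x w, N (J (x, w)) -> N (J (0, x *m theta + c *: w)%R)) ->
  natzeta K V s = \esum_(N in stable theta c) ((relindex setT N)%:R ^- s : K)%:E.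
Proof.
move=> JK J'K smodJ.
have J'A : zmod_morphism J'.
  by move=> u v; apply: (can_inj JK); rewrite raddfB !J'K.
pose J'M : {additive V -> E} := HB.pack J' (GRing.isZmodMorphism.Build _ _ _ J'A).
have J'JN (N : set V) : J' @^-1` (J @^-1` N) = N.
  by apply/seteqP; split=> v; rewrite /= J'K.
rewrite (@reindex_esum _ _ _ (@finite_index_submodules A V) (stable theta c)
  (fun N => J @^-1` N)).
  apply: eq_esum => N /finite_indexP[sN fN]; congr (_%:R ^- _)%:E.
  have [sJN _] := (smodJ N).1 sN.
  apply: (relindex_morph (f := J) (H := setT) _ (submod_subgroup sN) _ _ _ _).2 => //.
  - exact: submod_subgroup.
  - by move=> v _; exists (J' v); rewrite J'K subrr; apply: sN.1.
  - exact: finidx_preim.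
split=> [N /finite_indexP[sN fN]|N N' _ _ E|M [/finite_indexP[sM fM] stM]].
- have [sJN cJN] := (smodJ N).1 sN; split=> //.
  by apply/finite_indexP; split=> //; apply: finidx_preim.
- by rewrite -[N]J'JN -[N']J'JN; congr (J' @^-1` _).
- have JJM : J @^-1` (J' @^-1` M) = M by apply/seteqP; split=> v; rewrite /= JK.
  exists (J' @^-1` M) => //; apply/finite_indexP; split; last exact: (@finidx_preim _ _ J'M).
  by apply/smodJ; rewrite JJM; split=> // x w; rewrite /= !JK; apply: stM.
Qed.

End Transport.

(** * Convergence and quadratic extensions of k[[T]] *)

Section Convergence.
Variables (K : realType) (k : finFieldType).
Local Notation O := {fps k}.

(** The nonzero ideals of O, seen in the free module of rank 1. *)
Definition power_line n : set 'rV[O]_1 := row_span (fpsX ^+ n)%:M.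

Lemma power_lineP n (v : 'rV[O]_1) : power_line n v <-> exists h, v 0 0 = fpsX ^+ n * h.
Proof.
split=> [[u _ <-]|[h vh]]; first by exists (u 0 0); rewrite mul_mx_scalar mxE.
by exists h%:M => //; apply/rowP => i; rewrite ord1 mul_mx_scalar !mxE mulr1n.
Qed.

Lemma power_line_subgroup n : subgroup (power_line n).
Proof. exact/submod_subgroup/submod_row_span. Qed.

Lemma index_power_line n : finidx (power_line n) /\
  relindex setT (power_line n) = (#|k| ^ n)%N.
Proof.
elim: n => [|n [fn IH]].
  have -> : power_line 0 = setT.
    by apply/seteqP; split=> // v _; apply/power_lineP; exists (v 0 0); rewrite mul1r.
  by rewrite index_setT; split=> //; apply: finidx_setT.
have [f1 i1] : finidx (power_line 1) /\ relindex setT (power_line 1) = #|k|.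
  apply: (@residue_system_relindex _ _ _ _ (fun c : k => (fpsC c)%:M)).
    exact: power_line_subgroup.
  split=> // [v _|c c'].
    exists (coefs (v 0 0) 0); apply/power_lineP.
    have [|h hE] := @fps_divX _ (v 0 0 - fpsC (coefs (v 0 0) 0)).
      by rewrite coefsB subrr.
    by exists h; rewrite expr1 -hE !mxE mulr1n.
  move=> /power_lineP[h]; rewrite !mxE !mulr1n expr1 => /(congr1 (fun f => coefs f 0)).
  by rewrite coefsB coefsXM /= => /eqP; rewrite subr_eq0 => /eqP.
have [fS iS] : finite_set (coset (power_line n.+1) @` power_line 1) /\
    relindex (power_line 1) (power_line n.+1) = relindex setT (power_line n).
  apply: (relindex_morph (f := *:%R (fpsX : O))).
  - exact: power_line_subgroup.
  - exact: power_line_subgroup.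
  - move=> u; split=> /power_lineP[h]; rewrite ?mxE => uE; apply/power_lineP; exists h.
      apply/eqP; rewrite -subr_eq0; apply/eqP/(@fpsX_nzd _ 1).
      by rewrite expr1 mulrBr uE mulrA -exprS subrr.
    by rewrite mxE uE mulrA -exprS.
  - by move=> u; apply/power_lineP; exists (u 0 0); rewrite mxE.
  - move=> v /power_lineP[h vh]; exists h%:M.
    rewrite (_ : v - _ = 0); first exact: (power_line_subgroup _).1.
    by apply/rowP => i; rewrite ord1 !mxE vh mulr1n expr1 subrr.
  - exact: fn.
have S1 : power_line n.+1 `<=` power_line 1.
  move=> v /power_lineP[h vh]; apply/power_lineP.
  by exists (fpsX ^+ n * h); rewrite vh exprS mulrA.
have [fSS iSS] := relindex_tower (power_line_subgroup n.+1) (power_line_subgroup 1) S1 f1 fS.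
split; first exact: fSS.
by rewrite iSS expnS; congr (_ * _)%N; [exact: i1 | exact: etrans iS IH].
Qed.

Lemma power_line_ex (N : set 'rV[O]_1) :
  finite_index_submodules N -> exists n, power_line n = N.
Proof.
move=> /finite_indexP[sN fN]; have [B BN iB] := finidx_basis sN fN.
have B0 : B 0 0 != 0.
  apply/eqP => B00; have : (1%:M : 'rV[O]_1) = 0.
    by apply: iB; rewrite mul1mx; apply/matrixP => i j; rewrite !ord1 B00 mxE.
  by move/matrixP/(_ 0 0)/eqP; rewrite !mxE oner_eq0.
have [n [u [BE u0]]] := fps_val B0; have [u' uu'] := fps_unit u0.
exists n; rewrite -BN [B]mx11_scalar BE; apply/seteqP; split=> v.
  move=> /power_lineP[h vh]; exists (u' * h)%:M => //.
  apply/rowP => i; rewrite ord1 mul_mx_scalar !mxE mulr1n vh -mulrA.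
  by rewrite [u * _]mulrA uu' mul1r.
move=> [h _ <-]; apply/power_lineP; exists (u * h 0 0).
by rewrite mul_mx_scalar mxE mulrA.
Qed.

Local Open Scope ereal_scope.

(** The zeta function of O is the geometric series of ratio q^(-s). *)
Lemma natzeta_line s : (0 < s)%N -> natzeta K 'rV[O]_1 s < +oo.
Proof.
move=> s0; have q1 : (1 < #|k|)%N := card_finNzRing_gt1 k.
pose z : K := (#|k|%:R ^- s)%R.
have z0 : (0 <= z)%R by rewrite invr_ge0 exprn_ge0.
have z1 : (z < 1)%R.
  by rewrite invf_lt1 ?exprn_gt0 ?ltr0n ?(ltnW q1) // exprn_egt1 ?ltr1n // -lt0n.
rewrite /natzeta (_ : @finite_index_submodules O _ = range power_line); last first.
  apply/seteqP; split=> [N /power_line_ex[n <-]|_ [n _ <-]]; first by exists n.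
  by apply/finite_indexP; split; [apply: submod_row_span | case: (index_power_line n)].
rewrite esum_image; last first.
  move=> n n' _ _ E; apply/eqP; rewrite -(eqn_exp2l _ _ q1); apply/eqP.
  by rewrite -(index_power_line n).2 E (index_power_line n').2.
rewrite -nneseries_esumT; last by move=> n; rewrite lee_fin invr_ge0 exprn_ge0.
apply: (@le_lt_trans _ _ ((1 - z)^-1)%:E); last exact: ltry.
apply: lime_le.
  by apply: is_cvg_nneseries => n _ _; rewrite lee_fin invr_ge0 exprn_ge0.
apply: nearW => n; rewrite /= sumEFin lee_fin.
rewrite (eq_bigr (fun i => z ^+ i)%R); last first.
  move=> i _; rewrite -[Defs.index _]/(relindex setT _).
  by rewrite (index_power_line i).2 natrX exprAC exprVn.
rewrite -[leRHS]mul1r ler_pdivlMr ?subr_gt0 // mulrC big_mkord.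
by rewrite -opprB mulNr -subrX1 opprB lerBlDr lerDl exprn_ge0.
Qed.

Lemma natzeta_ge0 (A : comNzRingType) (V : lmodType A) s : 0 <= natzeta K V s.
Proof. by apply: esum_ge0 => N _; rewrite lee_fin invr_ge0 exprn_ge0. Qed.

Lemma natzeta_gt0 (A : comNzRingType) (V : lmodType A) s : 0 < natzeta K V s.
Proof.
have SV : finite_index_submodules [set: V].
  by apply/finite_indexP; split=> //; apply: finidx_setT.
apply: lt_le_trans (esum_ge _); last first.
  exists [set setT]; last by rewrite fsbig_set1.
  by split; [exact: finite_set1 | move=> _ ->].
by rewrite lte_fin invr_gt0 exprn_gt0 // ltr0n; apply: index_gt0 => //; apply: finidx_setT.
Qed.

(** The submodules of O^(1+d) fibre over those of O^d without any stability
    condition: [L] receives a factor [O^d : L] from the residues, which lowers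
    its exponent from 1+d to d. *)
Lemma natzeta_lty d : natzeta K 'rV[O]_d d < +oo.
Proof.
elim: d => [|d IH].
  rewrite /natzeta (_ : @finite_index_submodules O _ = [set setT]).
    by rewrite esum_set1 ?ltry // lee_fin expr0 invr1.
  apply/seteqP; split=> N; last first.
    by move=> ->; apply/finite_indexP; split=> //; apply: finidx_setT.
  move=> /finite_indexP[sN _]; apply/seteqP; split=> // v _.
  by rewrite (thinmx0 v); apply: sN.1.
pose J (p : 'rV[O]_1 * 'rV[O]_d) : 'rV[O]_(1 + d) := row_mx p.1 p.2.
have JA : zmod_morphism J by move=> p r; rewrite /J opp_row_mx add_row_mx.
pose JM : {additive 'rV[O]_1 * 'rV[O]_d -> 'rV[O]_(1 + d)} :=
  HB.pack J (GRing.isZmodMorphism.Build _ _ _ JA).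
have JZ a p : J (a *: p)%R = (a *: J p)%R by rewrite /J scale_row_mx.
pose J' (v : 'rV[O]_(1 + d)) : 'rV[O]_1 * 'rV[O]_d := (lsubmx v, rsubmx v).
have JK : cancel J J' by move=> [x w]; rewrite /J' /J row_mxKl row_mxKr.
have J'K : cancel J' J by move=> v; rewrite /J' /J hsubmxK.
rewrite (@natzeta_stable _ _ _ _ 0%R 0%R _ _ JM J') //; last first.
  move=> N; split=> [sN|[sJ _]].
    split=> [|x w _]; last by rewrite mulmx0 scale0r addr0 raddf0; apply: sN.1.
    split=> [|a u v Nu Nv] /=; first by rewrite [J 0%R](raddf0 JM); apply: sN.1.
    by rewrite [J _](raddfD JM) /= JZ; apply: sN.2.
  split=> [|a u v Nu Nv]; first by rewrite -(raddf0 JM); apply: sJ.1.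
  rewrite -[u]J'K -[v]J'K -JZ -[(_ + _)%R](raddfD JM).
  by apply: sJ.2; rewrite /= J'K.
have Z1 := @natzeta_line d.+1 isT.
rewrite esum_stable -(@fineK _ (natzeta K 'rV[O]_1 d.+1)); last first.
  by rewrite ge0_fin_numE // natzeta_ge0.
set Z := fine _.
rewrite (eq_esum (b := fun L => Z%:E * ((Defs.index L)%:R ^- d)%:E)).
  have Z0 : (0 <= Z)%R by apply/fine_ge0/natzeta_ge0.
  rewrite esumZl //; first exact: lte_mul_pinfty.
move=> L /finite_indexP[sL fL]; rewrite muleC; congr (_ * _%:E).
have -> : colon 0%R L = setT.
  by apply/seteqP; split=> // w _; rewrite /colon /= scale0r; apply: sL.1.
have -> : liftable 0%R 0%R L = (setT : set 'rV[O]_1).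
  apply/seteqP; split=> // w _; exists 0%R; rewrite mulmx0 scale0r addr0; exact: sL.1.
rewrite index_setT mul1r expr1 exprS invfM mulrA divff ?mul1r //.
by rewrite pnatr_eq0 -lt0n index_gt0 //; apply: submod_subgroup.
Qed.

Local Open Scope ring_scope.

(** The value depends neither on n nor on A.  In [esum_stable] with theta = 1 and
    c = T^n, the factor [(L : c) : L]^d from the residues cancels the factor
    [O^d : liftable L]^(-d), so that [L] contributes [O^d : L]^(-d) times the
    zeta sum of O^d. *)
Lemma natzeta_quadratic (A : comNzRingType) (sigma : {rmorphism O -> A}) (y : A) n d :
  y * y = sigma (fpsX ^+ n) * y ->
  (forall a, exists f g, a = sigma f + y * sigma g) ->
  (forall f g, sigma f + y * sigma g = 0 -> f = 0 /\ g = 0) ->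
  natzeta K 'rV[A]_d d = (natzeta K 'rV[O]_d d * natzeta K 'rV[O]_d d)%E.
Proof.
move=> yy gen free.
pose J (p : 'rV[O]_d * 'rV[O]_d) : 'rV[A]_d :=
  map_mx sigma p.1 + y *: map_mx sigma p.2.
have JA : zmod_morphism J.
  by move=> p r; rewrite /J !map_mxB scalerBr opprD addrACA.
pose JM : {additive 'rV[O]_d * 'rV[O]_d -> 'rV[A]_d} :=
  HB.pack J (GRing.isZmodMorphism.Build _ _ _ JA).
have Jinj p : J p = 0 -> p = 0.
  move=> Jp; rewrite [p]surjective_pairing.
  have pE i : p.1 0 i = 0 /\ p.2 0 i = 0.
    by apply: free; move/rowP/(_ i): Jp; rewrite !mxE.
  by congr pair; apply/rowP => i; rewrite mxE; have [] := pE i.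
have /choice[J' J'K] (v : 'rV[A]_d) : exists p, J p = v.
  have /choice[f fP] i : exists fg : O * O, v 0 i = sigma fg.1 + y * sigma fg.2.
    by have [f [g ->]] := gen (v 0 i); exists (f, g).
  exists (\row_i (f i).1, \row_i (f i).2).
  by apply/rowP => i; rewrite !mxE -fP.
have JK : cancel J J'.
  move=> p; apply/eqP; rewrite -subr_eq0; apply/eqP/Jinj.
  by rewrite JA J'K subrr.
have JZ f p : J (f *: p) = sigma f *: J p.
  case: p => x w; rewrite /J -[f *: (x, w)]/(f *: x, f *: w) /=.
  by rewrite !map_mxZ scalerDr !scalerA [y * _]mulrC.
have JY x w : J (0, x *m 1%:M + fpsX ^+ n *: w) = y *: J (x, w).
  rewrite /J /= map_mx0 add0r mulmx1 map_mxD map_mxZ !scalerDr !scalerA yy.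
  by rewrite [_ * y]mulrC.
rewrite (@natzeta_stable _ _ _ _ 1%:M (fpsX ^+ n) _ _ JM J') //; last first.
  move=> N; split=> [sN|[sJ cJ]].
    split=> [|x w Nxw]; last by rewrite [JM _]JY; apply: submodZ.
    split=> [|a u v Nu Nv] /=; first by rewrite [J 0](raddf0 JM); apply: sN.1.
    by rewrite [J _](raddfD JM) /= JZ; apply: sN.2.
  have gJ := submod_subgroup sJ.
  split=> [|a u v Nu Nv]; first by rewrite -(raddf0 JM); apply: sJ.1.
  have [f [g ->]] := gen a; rewrite scalerDl mulrC -scalerA.
  rewrite -[u]J'K -[v]J'K.
  have Ju : N (J (J' u)) by rewrite J'K.
  have Jv : (J @^-1` N) (J' v) by rewrite /= J'K.
  have Yu : (J @^-1` N) (0, (J' u).1 *m 1%:M + fpsX ^+ n *: (J' u).2).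
    by apply: cJ; rewrite -surjective_pairing.
  rewrite [y *: _](_ : _ = J (0, (J' u).1 *m 1%:M + fpsX ^+ n *: (J' u).2)); last first.
    by rewrite JY -surjective_pairing.
  rewrite -!JZ -!(raddfD JM).
  by apply: (subgroupD gJ) => //; apply: (subgroupD gJ); apply: submodZ.
rewrite esum_stable -(@fineK _ (natzeta K 'rV[O]_d d)); last first.
  by rewrite ge0_fin_numE ?natzeta_ge0 // natzeta_lty.
set Z := fine _; have Z0 : 0 <= Z by apply/fine_ge0/natzeta_ge0.
rewrite (eq_esum (b := fun L => (Z%:E * ((Defs.index L)%:R ^- d)%:E)%E)).
  rewrite esumZl //.
  by congr (_ * _)%E; rewrite /Z fineK // ge0_fin_numE ?natzeta_ge0 // natzeta_lty.
move=> L SL; rewrite muleC; congr (_ * _%:E)%E.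
have [sL fL] := (finite_indexP L).1 SL.
rewrite index_liftable_colon // exprMn invfM mulrA divff ?mul1r //.
rewrite expf_neq0 // pnatr_eq0 -lt0n -(index_liftable_colon _ SL).
have [sW fW] := (finite_indexP _).1 (finite_index_liftable 1%:M (fpsX ^+ n) SL).
by apply: index_gt0; [apply: submod_subgroup | apply: fW].
Qed.

End Convergence.

(** * The two rings *)

Section Weierstrass.
Variables (k : fieldType) (m : nat).
Local Notation X := (fpsX : {fps k}).
Implicit Types f q : {fps {fps k}}.

Lemma fpsX2_exp n : fpsX2 k ^+ n = fpsC (X ^+ n).
Proof. by elim: n => // n IH; rewrite !exprS IH (fpsC_morph _).2. Qed.

Lemma coefs_curve_multiple q n : coefs (q * curve_eq k m) n =
  if n is n'.+1 then (if n' is n''.+1 then coefs q n'' else 0) - X ^+ m * coefs q n' else 0.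
Proof.
rewrite mulrC /curve_eq -mulrA coefsXM; case: n => // n.
by rewrite mulrBl coefsB coefsXM fpsX2_exp coefsCM.
Qed.

Lemma fps_subst_from_rec f j : (0 < m)%N ->
  fps_subst_from m f j = coefs f j + X ^+ m * fps_subst_from m f j.+1.
Proof.
move=> m_gt0; apply: fpsP => n; rewrite coefsD coefsXnM /=.
rewrite [LHS]big_mkcond big_ord_recl /= muln0 subn0 addn0; congr (_ + _).
case: leqP => [le_mn|lt_nm]; last first.
  by rewrite big1 // => i _; rewrite ifN // -ltnNge (leq_trans lt_nm) // leq_pmulr.
have lt_nmS : (n - m < n)%N by rewrite ltn_subrL m_gt0 (leq_trans m_gt0).
rewrite (big_ord_widen_cond n (fun l => (m * l <= n - m)%N)
  (fun l => coefs (coefs f (j.+1 + l)%N) (n - m - m * l))) // [RHS]big_mkcond.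
apply: eq_bigr => i _; rewrite /bump leq0n add1n mulnS -leq_subRL // addSnnS subnDA.
have [le_i|_ //] := boolP (m * i <= n - m)%N.
by rewrite ltnS (leq_trans _ le_i) // leq_pmull.
Qed.

(** Comparing coefficients of Y^(j+2) in f = q (Y^2 - X^m Y) + a + b Y gives
    q_j = f_(j+2) + X^m q_(j+1), a recursion towards higher coefficients that
    converges X-adically; [fps_subst_from] is its solution. *)
Lemma weierstrass_division f : (0 < m)%N -> exists q a b,
  f = q * curve_eq k m + (fpsC a + fpsY2 k * fpsC b).
Proof.
move=> m_gt0; exists (Fps (fun j => fps_subst_from m f j.+2)), (coefs f 0), (fps_subst_from m f 1).
apply: fpsP => n; rewrite coefsD coefs_curve_multiple coefsD coefsXM /=.
case: n => [|[|n]] /=; first by rewrite addr0 add0r.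
  by rewrite (fps_subst_from_rec f 1 m_gt0) sub0r add0r addrC addrK.
by rewrite !addr0 (fps_subst_from_rec f n.+2 m_gt0) addrK.
Qed.

(** The same recursion with zero data makes q_0 divisible by every power of X. *)
Lemma weierstrass_unique q a b : (0 < m)%N ->
  fpsC a + fpsY2 k * fpsC b = q * curve_eq k m -> a = 0 /\ b = 0.
Proof.
move=> m_gt0 E; have En n := congr1 (fun f => coefs f n) E.
have a0 : a = 0 by have := En 0%N; rewrite coefs_curve_multiple coefsD coefsXM /= addr0.
have bE : b = - (X ^+ m * coefs q 0).
  by have := En 1%N; rewrite coefs_curve_multiple coefsD coefsXM /= add0r sub0r.
have qE l : coefs q 0 = X ^+ (m * l) * coefs q l.
  elim: l => [|l ->]; first by rewrite muln0 expr0 mul1r.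
  have := En l.+2; rewrite coefs_curve_multiple coefsD coefsXM /= addr0.
  by move/esym/eqP; rewrite subr_eq0 => /eqP ->; rewrite mulrA -exprD mulnSr.
have q0 : coefs q 0 = 0.
  by apply: fpsP => n; rewrite (qE n.+1) coefsXnM leqNgt leq_pmull.
by rewrite a0 bE q0 mulr0 oppr0.
Qed.

End Weierstrass.

Section Rings.
Variables (K : realType) (k : finFieldType) (d : nat).
Local Notation O := {fps k}.

Lemma natzeta_normalization :
  natzeta K 'rV[O * O]_d d = (natzeta K 'rV[O]_d d * natzeta K 'rV[O]_d d)%E.
Proof.
pose diag (f : O) : O * O := (f, f).
have dA : zmod_morphism diag by [].
have dM : monoid_morphism diag by [].
pose sigma : {rmorphism O -> O * O} := HB.pack diag
  (GRing.isZmodMorphism.Build _ _ _ dA) (GRing.isMonoidMorphism.Build _ _ _ dM).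
apply: (@natzeta_quadratic _ _ _ sigma (0, 1) 0).
- by congr pair; rewrite /= ?mulr0 // expr0 mulr1.
- move=> [f g]; exists f, (g - f); congr pair.
    by rewrite /= mul0r addr0.
  by rewrite /= mul1r addrC subrK.
- move=> f g E; have f0 : f = 0.
    by have := congr1 fst E; rewrite /= mul0r addr0.
  by split=> //; have := congr1 snd E; rewrite /= f0 mul1r add0r.
Qed.

Lemma natzeta_R2 m : (0 < m)%N ->
  natzeta K 'rV[R2 k m]_d d = (natzeta K 'rV[O]_d d * natzeta K 'rV[O]_d d)%E.
Proof.
move=> m0.
pose piR : {fps O} -> R2 k m := \pi_({ideal_quot @curve_ideal k m}).
have piRB f g : piR (f - g) = piR f - piR g by exact: rmorphB.
have piRD f g : piR (f + g) = piR f + piR g by exact: rmorphD.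
have piRM f g : piR (f * g) = piR f * piR g by exact: rmorphM.
have piR1 : piR 1 = 1 by exact: rmorph1.
have piR0 : piR 0 = 0 by exact: rmorph0.
have piRE f g : piR f = piR g <-> exists q, f - g = q * curve_eq k m.
  split=> [/eqP|E].
    by rewrite -Quotient.idealrBE => /asboolP.
  by apply/eqP; rewrite -Quotient.idealrBE; apply/asboolP.
pose s (c : O) := piR (fpsC c).
have sA : zmod_morphism s by move=> a b; rewrite /s (fpsC_morph _).1 piRB.
have sM : monoid_morphism s.
  by split=> [|a b]; rewrite /s ?(fpsC_morph _).2.
pose sigma : {rmorphism O -> R2 k m} := HB.pack s
  (GRing.isZmodMorphism.Build _ _ _ sA) (GRing.isMonoidMorphism.Build _ _ _ sM).
apply: (@natzeta_quadratic _ _ _ sigma (piR (fpsY2 k)) m).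
- rewrite /= /s -!piRM; apply/piRE; exists 1.
  by rewrite mul1r /curve_eq mulrBr fpsX2_exp [fpsC _ * _]mulrC.
- move=> x; have [q [a [b E]]] := weierstrass_division (repr x) m0.
  exists a, b; rewrite /= /s -piRM -piRD -[x]reprK; apply/piRE; exists q.
  by rewrite {1}E addrK.
- move=> a b; rewrite /= /s -piRM -piRD -piR0 => /piRE[q].
  by rewrite subr0; apply: weierstrass_unique.
Qed.

End Rings.

Theorem theorem10p5 (K : realType) (k : finFieldType) (m : nat) (d : nat) :
  (1 <= m)%N ->
  nu_hat (R2 k m) ({fps k} * {fps k})%type d (0 : K) = 1.
Proof.
move=> m0; rewrite /nu_hat !natzeta_coh_zeta natzeta_normalization natzeta_R2 //.
rewrite divff // fine_eq0; last first.
  by rewrite fin_numM // ge0_fin_numE ?natzeta_ge0 // natzeta_lty.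
by rewrite mule_eq0 negb_or andbb gt_eqF // natzeta_gt0.
Qed.
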